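(* Let $G$ be a connected finite simple graph with maximum degree $\Delta\ge 2$ that is not isomorphic to the cycle $C_7$. Then $\chi'_{(0,1)}(G)\le \Delta^2-1$.
   Context: All graphs are finite, simple and undirected. Two distinct edges $e,f$ are at distance $1$ if they share an endvertex; they are at distance $2$ if they share no endvertex but some edge of $G$ is adjacent to (shares an endvertex with) both of them. For nonnegative integers $s,t,k$, an $(s,t)$-relaxed strong $k$-edge-coloring of $G$ is an assignment of at most $k$ colors to the edges of $G$ such that for each edge $e$, at most $s$ edges at distance $1$ from $e$ and at most $t$ edges at distance $2$ from $e$ receive the same color as $e$. The $(s,t)$-relaxed strong chromatic index $\chi'_{(s,t)}(G)$ is the least $k$ for which such a coloring exists. $C_n$ denotes the cycle on $n$ vertices. *)

(* Defs.v *)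
From mathcomp Require Import all_boot.
Set Implicit Arguments. Unset Strict Implicit. Unset Printing Implicit Defensive.

(* A finite simple graph: vertex type T : finType, adjacency e : rel T,
   assumed symmetric and irreflexive (hypotheses of the theorem).
   Edges are the 2-element vertex sets {x,y} with e x y. *)
Definition edges (T : finType) (e : rel T) : {set {set T}} :=
  [set [set p.1; p.2] | p in [set p : T * T | e p.1 p.2]].

Definition edist1 (T : finType) (f g : {set T}) : bool :=
  (f != g) && (f :&: g != set0).

Definition edist2 (T : finType) (e : rel T) (f g : {set T}) : bool :=
  (f :&: g == set0) &&
  [exists h in edges e, (h :&: f != set0) && (h :&: g != set0)].

(* c is an (s,t)-relaxed strong k-edge-coloring of G (colors in 'I_k;
   values of c on non-edges are irrelevant). *)
Definition relaxed_strong_coloring (T : finType) (e : rel T) (s t k : nat)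
    (c : {set T} -> 'I_k) : Prop :=
  forall f, f \in edges e ->
    #|[set g in edges e | edist1 f g & c g == c f]| <= s /\
    #|[set g in edges e | edist2 e f g & c g == c f]| <= t.

Definition degree (T : finType) (e : rel T) (x : T) : nat := #|[set y | e x y]|.

Definition max_degree (T : finType) (e : rel T) : nat := \max_(x : T) degree e x.

Definition connected (T : finType) (e : rel T) : Prop :=
  forall x y : T, connect e x y.

Definition cycle7 : rel 'I_7 :=
  fun i j => (j == (i + 1) %% 7 :> nat) || (i == (j + 1) %% 7 :> nat).

Definition isomorphic_to_C7 (T : finType) (e : rel T) : Prop :=
  exists f : T -> 'I_7, bijective f /\ forall x y, e x y = cycle7 (f x) (f y).

(* Main.v *)
Require Import Defs.
From mathcomp Require Import all_boot zify.
Set Implicit Arguments. Unset Strict Implicit. Unset Printing Implicit Defensive.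

(** Give weight 2 to two equally colored edges at distance 1 and weight 1 to
    two equally colored edges at distance 2, and take a coloring with
    [k = D ^ 2 - 1] colors of least total weight (the energy).  The weights
    around an edge add up to at most [2 k], so an edge that violates the
    condition must see weight exactly 2 in every color: recoloring it, that
    is, treating it as a hole, never changes the energy, and the hole can be
    moved to any incident edge.  Hence every edge can become the hole and
    [G] is [D]-regular.
    If [2 < D], the first vertex [x] of a maximal path [x, u, v, ...] has two
    more neighbors [y], [z] on the path, in this order.  Move the hole from
    [uv] along the path to [yx], let it turn around the triangle that [xy],
    [xu], [xz] form in the line graph, and move it back: this swaps the
    colors of [xu] and [xz] only, and so changes the weight seen from [uv],
    because [xu] is incident with [uv] and [xz] is not; a contradiction.
    If [D = 2], then [G] is a cycle, which is colored explicitly. *)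

(** * Weights of pairs of edges and the total weight seen from an edge *)

Section Weights.

Variables (T : finType) (e : rel T).
Hypotheses (symE : symmetric e) (irrE : irreflexive e).

Local Notation D := (max_degree e).
Local Notation E := (edges e).

Lemma edgesP f : reflect (exists x y, e x y /\ f = [set x; y]) (f \in E).
Proof.
apply: (iffP imsetP) => [[[x y]]|[x [y [exy ->]]]].
  by rewrite inE /= => exy ->; exists x, y.
by exists (x, y); rewrite ?inE.
Qed.

Lemma mem_edges x y : e x y -> [set x; y] \in E.
Proof. by move=> exy; apply/edgesP; exists x, y. Qed.

Lemma adj_neq x y : e x y -> x != y.
Proof. by apply: contraTneq => ->; rewrite irrE. Qed.

Lemma edge_neq0 f : f \in E -> f :&: f != set0.
Proof.
by case/edgesP=> x [y [_ ->]]; rewrite setIid; apply/set0Pn;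
  exists x; rewrite !inE eqxx.
Qed.

Lemma edges_through x f : f \in E -> x \in f -> exists2 y, e x y & f = [set x; y].
Proof.
case/edgesP=> a [b [eab ->]]; rewrite !inE => /orP[]/eqP->; first by exists b.
by exists a; rewrite 1?symE // setUC.
Qed.

Lemma set2_inj (x y z : T) : [set x; y] = [set x; z] -> y = z.
Proof.
move=> eq_xyz; have := set22 x y; rewrite eq_xyz !inE => /orP[/eqP y_eq|/eqP //].
by have := set22 x z; rewrite -eq_xyz y_eq !inE orbb => /eqP.
Qed.

Lemma edist1_sym (f g : {set T}) : edist1 f g = edist1 g f.
Proof. by rewrite /edist1 eq_sym setIC. Qed.

Lemma edist2_sym (f g : {set T}) : edist2 e f g = edist2 e g f.
Proof.
rewrite /edist2 setIC; congr (_ && _).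
by apply: eq_existsb => h; rewrite (andbC (h :&: f != _)).
Qed.

Lemma edist1_common x (f g : {set T}) : x \in f -> x \in g -> f != g -> edist1 f g.
Proof.
move=> xf xg neq; rewrite /edist1 neq; apply/set0Pn.
by exists x; rewrite inE xf.
Qed.

(* With these weights the weighted number of edges near a given edge is at
   most 2 (D ^ 2 - 1), that is, on average 2 per color. *)
Definition weight (f g : {set T}) : nat := (edist1 f g).*2 + edist2 e f g.

Lemma weight_sym f g : weight f g = weight g f.
Proof. by rewrite /weight edist1_sym edist2_sym. Qed.

Lemma weight_self f : f \in E -> weight f f = 0.
Proof.
move=> fE; rewrite /weight /edist1 /edist2 eqxx /=.
by rewrite (negPf (edge_neq0 fE)).
Qed.

Lemma weight_edist1 f g : edist1 f g -> weight f g = 2.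
Proof.
by rewrite /weight => d1; rewrite d1; case/andP: d1 => _; rewrite /edist2 => /negPf->.
Qed.

Lemma card_dist1 u v : e u v ->
  #|[set g in E | edist1 [set u; v] g]| <= (degree e u).-1 + (degree e v).-1.
Proof.
move=> euv; pose N a b := [set [set a; y] | y in [set y | e a y] :\ b].
have cardN a b : e a b -> #|N a b| <= (degree e a).-1.
  move=> eab; apply: leq_trans (leq_imset_card _ _) _.
  by rewrite /degree [X in _ <= X.-1](cardsD1 b) inE eab.
apply: leq_trans (leq_add (cardN _ _ euv) (cardN v u _)); last by rewrite symE.
apply: leq_trans (subset_leq_card _) (leq_card_setU _ _).
apply/subsetP=> g; rewrite inE => /and3P[gE neq /set0Pn[x]].
rewrite inE => /andP[+ xg]; have [y exy g_eq] := edges_through gE xg.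
rewrite !inE => /orP[]/eqP x_eq; apply/orP; [left|right]; apply/imsetP; exists y;
  rewrite ?g_eq ?x_eq // !inE -x_eq exy andbT.
  by apply: contraNneq neq => y_eq; rewrite g_eq x_eq y_eq.
by apply: contraNneq neq => y_eq; rewrite g_eq x_eq y_eq setUC.
Qed.

Lemma leq_degree x : degree e x <= D.
Proof. exact: leq_bigmax. Qed.

Lemma leq_card_bigcup (I : finType) (U : finType) (A : {set I}) (F : I -> {set U}) m :
  (forall i, i \in A -> #|F i| <= m) -> #|\bigcup_(i in A) F i| <= #|A| * m.
Proof.
move=> leF; apply: (@leq_trans (\sum_(i in A) #|F i|)).
  elim/big_rec2: _ => [|i a b _ le]; first by rewrite cards0.
  by apply: leq_trans (leq_card_setU _ _) _; rewrite leq_add2l.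
by rewrite -sum_nat_const; apply: leq_sum.
Qed.

(** A connecting edge leads from [u] or [v] to a further vertex [x], which has at most [D.-1] other
    edges. *)
Lemma card_dist2 u v : e u v ->
  #|[set g in E | edist2 e [set u; v] g]|
    <= ((degree e u).-1 + (degree e v).-1) * D.-1.
Proof.
move=> euv; pose N a b := [set y | e a y] :\ b.
pose M a b := \bigcup_(x in N a b) [set [set x; y] | y in N x a].
have cardN a b : e a b -> #|N a b| = (degree e a).-1.
  by move=> eab; rewrite /degree [in RHS](cardsD1 b) inE eab.
have cardM a b : e a b -> #|M a b| <= (degree e a).-1 * D.-1.
  move=> eab; rewrite -(cardN _ _ eab); apply: leq_card_bigcup => x.
  rewrite !inE => /andP[_ eax]; apply: leq_trans (leq_imset_card _ _) _.
  by rewrite cardN 1?symE // -!subn1 leq_sub2r ?leq_degree.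
rewrite mulnDl.
apply: leq_trans (leq_add (cardM _ _ euv) (cardM v u _)); last by rewrite symE.
apply: leq_trans (subset_leq_card _) (leq_card_setU _ _).
apply/subsetP=> g; rewrite inE => /and3P[gE dis /existsP[h]].
case/and3P=> hE /set0Pn[a]; rewrite inE => /andP[ah auv] /set0Pn[x].
rewrite inE => /andP[xh xg].
have notin z : z \in g -> z \notin [set u; v].
  by move=> zg; apply: contraTN dis => zuv; apply/set0Pn; exists z; rewrite inE zuv.
have [b eab h_eq] := edges_through hE ah.
have x_eq : x = b.
  move: xh; rewrite h_eq !inE => /orP[]/eqP // x_eq.
  by case/negP: (notin _ xg); rewrite x_eq.
have [y exy g_eq] := edges_through gE xg.
have := notin _ xg; have := notin y; rewrite g_eq set22 => /(_ isT).
rewrite !inE !negb_or => /andP[yu yv] /andP[xu xv].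
move: auv; rewrite !inE => /orP[]/eqP a_eq; apply/orP; [left|right];
  apply/bigcupP; exists x; rewrite ?inE ?xu ?xv ?x_eq -?a_eq ?eab //;
  by rewrite -x_eq; apply/imsetP; exists y; rewrite ?inE ?exy ?a_eq ?yu ?yv.
Qed.

Lemma sum_weight f : \sum_(g in E) weight f g =
  #|[set g in E | edist1 f g]|.*2 + #|[set g in E | edist2 e f g]|.
Proof.
have count (P : pred {set T}) : \sum_(g in E) P g = #|[set g in E | P g]|.
  rewrite -sum1_card; under [RHS]eq_bigl => g do rewrite inE.
  by rewrite big_mkcondr; apply: eq_bigr => g _; case: (P g).
rewrite /weight big_split /= count; congr (_ + _).
by under eq_bigr => g _ do rewrite -mul2n; rewrite -big_distrr /= count mul2n.
Qed.

(** Each edge incident with [uv] accounts for its own weight 2 and for at most [D.-1] edges at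
    distance 2, whence the factor [D.+1]. *)
Lemma sum_weight_le u v : e u v ->
  \sum_(g in E) weight [set u; v] g
    <= ((degree e u).-1 + (degree e v).-1) * D.+1.
Proof.
move=> euv; rewrite sum_weight.
have D_gt0 : 0 < D.
  by apply: leq_trans (leq_degree u); apply/card_gt0P; exists v; rewrite inE.
have := card_dist1 euv; have := card_dist2 euv.
have -> : D.+1 = 2 + D.-1 by lia.
by rewrite mulnDr muln2 -!mul2n; lia.
Qed.

Lemma sum_weight_max f : f \in E -> 0 < D ->
  \sum_(g in E) weight f g <= (D ^ 2 - 1) * 2.
Proof.
case/edgesP=> u [v [euv ->]] D_gt0; apply: leq_trans (sum_weight_le euv) _.
have := leq_degree u; have := leq_degree v; nia.
Qed.

Lemma full_degree u v : e u v -> 1 < D ->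
  \sum_(g in E) weight [set u; v] g = (D ^ 2 - 1) * 2 -> degree e u = D.
Proof.
move=> euv D_gt1 full; have := sum_weight_le euv; rewrite full.
have := leq_degree u; have := leq_degree v; nia.
Qed.

End Weights.

(** * Colorings of least energy and moves of the hole *)

Section Recoloring.

Variables (T : finType) (e : rel T) (k : nat).

Local Notation E := (edges e).
Local Notation w := (weight e).
Local Notation coloring := {ffun {set T} -> 'I_k}.
Implicit Types (c : coloring) (f g h : {set T}).

Hypothesis row_sum : forall f, f \in E -> \sum_(g in E) w f g <= k * 2.

Definition color_weight c f b := \sum_(g in E | c g == b) w f g.

Definition energy c := \sum_(f in E) color_weight c f (c f).

Definition recolor c f b : coloring := [ffun g => if g == f then b else c g].

Lemma recolorE c f b : recolor c f b f = b.
Proof. by rewrite ffunE eqxx. Qed.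

Lemma recolor_neq c f b g : g != f -> recolor c f b g = c g.
Proof. by rewrite ffunE => /negPf->. Qed.

Lemma color_weight_other c f b : f \in E ->
  color_weight c f b = \sum_(g in E :\ f) (c g == b) * w f g.
Proof.
move=> fE; rewrite /color_weight big_mkcondr /= (bigD1 f) //= weight_self // if_same.
rewrite add0n; apply: eq_big => [g|g _]; first by rewrite !inE andbC.
by case: (c g == b); rewrite ?mul1n ?mul0n.
Qed.

Lemma eq_color_weight c c' f b : f \in E ->
  (forall g, g != f -> c g = c' g) -> color_weight c f b = color_weight c' f b.
Proof.
move=> fE eq_c; rewrite !color_weight_other //.
by apply: eq_bigr => g; rewrite !inE => /andP[/eq_c->].
Qed.

(** Pairs containing [f] occur in both orders, whence the doubling; the remaining sum does not
    depend on the color of [f]. *)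
Lemma energy_split c f : f \in E ->
  energy c = (color_weight c f (c f)).*2
    + \sum_(g in E :\ f) \sum_(h in E :\ f) (c h == c g) * w g h.
Proof.
move=> fE; rewrite /energy (bigD1 f) //= -addnn -addnA; congr (_ + _).
have eq1 : (fun g => (g \in E) && (g != f)) =1 (fun g => g \in E :\ f).
  by move=> g; rewrite !inE andbC.
rewrite (eq_bigl _ _ eq1) color_weight_other // -big_split /=.
apply: eq_bigr => g _; rewrite /color_weight big_mkcondr /= (bigD1 f) //=.
congr (_ + _).
  by rewrite eq_sym weight_sym; case: (_ == _); rewrite ?mul1n ?mul0n.
rewrite (eq_bigl _ _ eq1); apply: eq_bigr => h _.
by case: (_ == _); rewrite ?mul1n ?mul0n.
Qed.

Lemma energy_recolor c f b : f \in E ->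
  energy (recolor c f b) + (color_weight c f (c f)).*2
    = energy c + (color_weight c f b).*2.
Proof.
move=> fE; rewrite !(energy_split _ fE) recolorE.
rewrite (@eq_color_weight _ c) //; last by move=> g; apply: recolor_neq.
rewrite addnAC [RHS]addnC addnA; congr (_ + _).
apply: eq_bigr => g; rewrite !inE => /andP[gf _]; apply: eq_bigr => h.
by rewrite !inE => /andP[hf _]; rewrite !recolor_neq.
Qed.

(* The color of [f] itself is irrelevant here: [f] can be thought of as an
   uncolored edge, a hole that can be moved to any incident edge. *)
Definition hole c f :=
  [/\ f \in E, forall c', energy c <= energy c' & forall b, color_weight c f b = 2].

Lemma sum_color_weight c f : \sum_b color_weight c f b = \sum_(g in E) w f g.
Proof.
by rewrite (partition_big c predT).
Qed.

(** A color of weight below 2 at [f] could be given to [f], lowering the energy. The [k] weights add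
    up to at most [k * 2], so all are equal to 2. *)
Lemma hole_bad c f : f \in E -> (forall c', energy c <= energy c') ->
  2 <= color_weight c f (c f) -> hole c f.
Proof.
move=> fE min bad; have ge2 b : 2 <= color_weight c f b.
  have := energy_recolor c b fE; have := min (recolor c f b); lia.
split=> // b; apply/eqP; rewrite eqn_leq ge2 andbT.
have := row_sum fE; rewrite -(sum_color_weight c) (bigD1 b) //=.
have : \sum_(i < k | i != b) 2 <= \sum_(i < k | i != b) color_weight c f i.
  by apply: leq_sum.
have : \sum_(i < k) 2 = 2 + \sum_(i < k | i != b) 2 by rewrite (bigD1 b).
rewrite sum_nat_const card_ord => -> le_rest.
rewrite -[in X in _ -> X](leq_add2r (\sum_(i < k | i != b) 2)).
by apply: leq_trans; rewrite leq_add2l.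
Qed.

Lemma hole_full c f : hole c f -> \sum_(g in E) w f g = k * 2.
Proof.
case=> fE _ eq2; rewrite -(sum_color_weight c) (eq_bigr _ (fun b _ => eq2 b)).
by rewrite sum_nat_const card_ord.
Qed.

(** The incident edge [g] already uses up the weight 2 of its color. *)
Lemma hole_unique c f g h : hole c f -> g \in E -> h \in E -> h != g ->
  c g = c h -> edist1 f g -> w f h = 0.
Proof.
case=> fE _ /(_ (c g)) + gE hE hg gh /weight_edist1 fg.
rewrite /color_weight (bigD1 g) ?gE ?eqxx //= fg (bigD1 h) /=; first lia.
by rewrite hE gh eqxx.
Qed.

(** All colors weigh 2 at [f], so giving it the color of [g] keeps the energy minimal; then [f]
    alone makes [g] see weight 2 in its own color. *)
Lemma hole_move c f g : hole c f -> g \in E -> edist1 f g ->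
  hole (recolor c f (c g)) g.
Proof.
move=> [fE min eq2] gE fg; have gf : g != f by rewrite eq_sym; case/andP: fg.
apply: hole_bad => // [c'|].
  apply: leq_trans (min c').
  have := energy_recolor c (c g) fE; rewrite !eq2; lia.
rewrite recolor_neq // /color_weight (bigD1 f) /=.
  by rewrite weight_edist1 1?edist1_sym.
by rewrite fE recolorE eqxx.
Qed.

(** The color [c' f] is left free, since the color of a hole does not matter. *)
Definition swappable (p q f : {set T}) := forall c, hole c f ->
  c p != c q /\ exists c', [/\ hole c' f, c' p = c q, c' q = c p
    & forall h, h != f -> h != p -> h != q -> c' h = c h].

Lemma edist1_neq f g : edist1 f g -> f != g. Proof. by case/andP. Qed.

(* The hole goes around the triangle formed by [f], [p] and [q]. *)
Lemma swappable_adjacent p q f : p \in E -> q \in E -> f \in E ->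
  edist1 f p -> edist1 f q -> edist1 p q -> swappable p q f.
Proof.
move=> pE qE fE fp fq pq c hc; have pq' := edist1_neq pq.
have fp' := edist1_neq fp; have fq' := edist1_neq fq; split.
  (* Otherwise [q], incident with [f], would exceed the weight 2 that [p] already gives to their
     common color. *)
  apply/eqP => eq_pq.
  have := hole_unique hc pE qE _ eq_pq fp.
  by rewrite eq_sym weight_edist1 // => /(_ pq').
(* The hole visits [p], [q] and [f]; meanwhile [f] stores the color of [p] until [q] receives it. *)
have h1 := hole_move hc pE fp; have h2 := hole_move h1 qE pq.
have h3 := hole_move h2 fE; rewrite edist1_sym in h3.
eexists; split; first exact: h3.
- by rewrite recolor_neq // recolorE recolor_neq // eq_sym.
- by rewrite recolorE recolor_neq // recolorE.
by move=> h hf hp hq; rewrite !recolor_neq.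
Qed.

(** The hole moves to [g], the swap takes place there, and the hole returns; [f] keeps the color of
    [g] in between and hands it back. *)
Lemma swappable_step p q f g : f \in E -> g \in E -> edist1 f g ->
  f != p -> f != q -> g != p -> g != q -> swappable p q g -> swappable p q f.
Proof.
move=> fE gE fg fp fq gp gq sw c hc; have fg' := edist1_neq fg.
have [] := sw _ (hole_move hc gE fg).
rewrite !recolor_neq 1?eq_sym // => neq [c' [hc' cp cq ch]]; split=> //.
have hf := hole_move hc' fE; rewrite edist1_sym in hf.
exists (recolor c' g (c' f)); split; first exact: hf.
- by rewrite recolor_neq // eq_sym.
- by rewrite recolor_neq // eq_sym.
move=> h hf' hp hq; have [->|hg] := eqVneq h g.
  by rewrite recolorE ch // recolorE.
by rewrite recolor_neq // ch // recolor_neq.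
Qed.

(* Swapping the colors of [p] and [q] would remove the color of [p] from the
   edges incident with [f], where it carries the whole weight 2. *)
Lemma swappable_no_hole p q f c : p \in E -> q \in E -> p != q ->
  edist1 f p -> ~~ edist1 f q -> swappable p q f -> ~ hole c f.
Proof.
move=> pE qE pq fp fq sw hc; have [neq [c' [hc' cp cq ch]]] := sw c hc.
have fE : f \in E by case: hc.
case: hc' => _ _ /(_ (c p)); rewrite /color_weight (bigD1 q) /=; last first.
  by rewrite qE cq eqxx.
(* Apart from [q] the color contributes nothing, and [q], not incident with [f], contributes at most
   1, short of 2. *)
rewrite big1 => [|h /andP[/andP[hE /eqP hp] hq]].
  by rewrite /weight (negPf fq); case: edist2.
have [->|hf] := eqVneq h f; first exact: weight_self.
have [hp'|hp'] := eqVneq h p; first by move: neq; rewrite -hp hp' cp eqxx.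
by apply: (hole_unique hc pE hE _ _ fp); rewrite // -hp ch.
Qed.

(** Steps back along the path from the closing edge to [uv]. The path edges avoid [x], hence differ
    from [p] and [q]. *)
Lemma swappable_path (p q : {set T}) x u v s : e u v -> path e v s -> e (last v s) x ->
  x \notin [:: u, v & s] -> uniq [:: u, v & s] -> x \in p -> x \in q ->
  p != [set last v s; x] -> q != [set last v s; x] ->
  swappable p q [set last v s; x] -> swappable p q [set u; v].
Proof.
move=> + + + + + xp xq.
have off a b (r : {set T}) : x \in r -> x \notin [:: a; b] -> [set a; b] != r.
  by move=> xr; apply: contraNneq => eq_r; move: xr; rewrite -eq_r !inE.
elim: s u v => [|t s IHs] u v /= euv.
  move=> _ evx xN _ pN qN; apply: swappable_step;
    rewrite ?mem_edges ?(off u v) // 1?eq_sym //.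
  apply: (@edist1_common _ v); rewrite ?inE ?eqxx ?orbT //.
  by apply: off; rewrite // !inE eqxx orbT.
case/andP=> evt vs ex xN /and3P[uN vN sU] pN qN sw.
have xN' : x \notin [:: v, t & s] by move: xN; rewrite inE negb_or => /andP[].
have sw' := IHs v t evt vs ex xN' _ pN qN sw.
have xuv : x \notin [:: u; v].
  by move: xN; rewrite !inE !negb_or => /and4P[-> ->].
have xvt : x \notin [:: v; t].
  by move: xN'; rewrite !inE !negb_or => /and3P[-> ->].
apply: swappable_step (sw' _); rewrite ?mem_edges ?off //; last by rewrite /= vN.
apply: (@edist1_common _ v); rewrite ?inE ?eqxx ?orbT //.
apply: contraNneq uN => eq_uv; have := set21 u v.
by rewrite eq_uv !inE => /orP[]->; rewrite ?orbT.
Qed.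

End Recoloring.

(** * Maximal paths and the case of degree at least 3 *)

Section Paths.

Variables (T : finType) (e : rel T).
Hypotheses (symE : symmetric e) (irrE : irreflexive e).

Local Notation E := (edges e).

(** The path grows at its first vertex while that vertex has a neighbor off the path; [n] below
    bounds the remaining growth. *)
Lemma maximal_path (x0 : T) : exists x p,
  [/\ path e x p, uniq (x :: p) & forall y, e x y -> y \in p].
Proof.
suff: forall n x p, #|T| - size p <= n -> path e x p -> uniq (x :: p) ->
    exists x p, [/\ path e x p, uniq (x :: p) & forall y, e x y -> y \in p].
  by move/(_ _ x0 [::] (leqnn _)); apply.
elim=> [|n IHn] x p le_n xp xpU.
  move: le_n; rewrite leqn0 subn_eq0 leqNgt => /negP[].
  by have := max_card [in x :: p]; rewrite (card_uniqP xpU).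
have [all_in|/forallPn[y]] := boolP [forall y, e x y ==> (y \in p)].
  by exists x, p; split=> // y exy; apply: (implyP (forallP all_in y)).
rewrite negb_imply => /andP[exy yp]; apply: (IHn y (x :: p)).
- by rewrite /= subnS; case: (_ - _) le_n.
- by rewrite /= symE exy.
rewrite cons_uniq xpU andbT inE negb_or yp andbT.
by rewrite eq_sym (adj_neq irrE exy).
Qed.

(** The swapped edges are [xu] and [xz]; with the closing edge they form the triangle at [x], and
    only [xu] meets [uv]. *)
Lemma chord_no_hole k (c : {ffun {set T} -> 'I_k}) x u v s z :
  (forall f, f \in E -> \sum_(g in E) weight e f g <= k * 2) ->
  path e x [:: u, v & s] -> uniq [:: x, u, v & s] -> e (last v s) x ->
  e x z -> z \notin [:: u, v & s] -> ~ hole e c [set u; v].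
Proof.
move=> row_sum /= /and3P[exu euv vs] /andP[xN uvs] eyx exz zN.
set y := last v s in eyx *; have ys : y \in v :: s by apply: mem_last.
have xz : x != z by apply: (adj_neq irrE).
have [xu xv] : x != u /\ x != v by move: xN; rewrite !inE !negb_or => /and3P[].
have [zu zv] : z != u /\ z != v by move: zN; rewrite !inE !negb_or => /and3P[].
have uy : u != y by apply: contraTneq ys => <-; case/andP: uvs.
have zy : z != y.
  by apply: contraNneq zN => ->; rewrite inE ys orbT.
have neq a b : a != b -> [set x; a] != [set x; b].
  by apply: contraNneq => /set2_inj->.
have inx a : x \in [set x; a] by rewrite set21.
have exy : e x y by rewrite symE.
have uz : u != z by rewrite eq_sym.
have yu : y != u by rewrite eq_sym.
have yz : y != z by rewrite eq_sym.
apply: (@swappable_no_hole _ _ _ [set x; u] [set x; z]);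
  rewrite ?mem_edges ?neq //.
- apply: (@edist1_common _ u); rewrite ?inE ?eqxx ?orbT //.
  by apply: contraNneq xv => eq_uv; move: (inx u); rewrite -eq_uv !inE (negPf xu).
- rewrite /edist1 negb_and !negbK; apply/orP; right; apply/eqP/setP=> a.
  rewrite !inE; apply/negP=> /andP[/orP[]/eqP-> /orP[]];
  by apply/negP; rewrite // eq_sym.
apply: (@swappable_path _ _ _ row_sum _ _ x u v s);
  rewrite ?inx // ?[[set _; x]]setUC ?neq //.
apply: (swappable_adjacent row_sum); rewrite ?mem_edges //;
  by apply: (@edist1_common _ x); rewrite ?inx ?neq.
Qed.

Lemma three_neighbors_no_hole k x p :
  (forall f, f \in E -> \sum_(g in E) weight e f g <= k * 2) ->
  path e x p -> uniq (x :: p) -> (forall y, e x y -> y \in p) ->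
  2 < degree e x ->
  exists u v, e u v /\ forall c : {ffun {set T} -> 'I_k}, ~ hole e c [set u; v].
Proof.
move=> row_sum; case: p => [_ _ all_in|u p xp xpU all_in deg].
  move=> /ltnW/ltnW/card_gt0P[y].
  by rewrite inE => /all_in.
have /card_gt1P[y [z [yN zN neq]]] : 1 < #|[set y | e x y] :\ u|.
  by move: deg; rewrite /degree (cardsD1 u); case: (_ \in _) => /=; lia.
wlog lt_yz : y z yN zN neq / index y p < index z p.
  move=> gen; case: (ltngtP (index y p) (index z p)); [exact: gen | |].
    by apply: gen; rewrite // eq_sym.
  move: yN zN; rewrite !inE => /andP[yu /all_in+] /andP[zu /all_in].
  rewrite !inE (negPf yu) (negPf zu) /= => yp zp /(congr1 (nth x p)).
  by rewrite !nth_index // => eq_yz; rewrite eq_yz eqxx in neq.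
move: yN zN; rewrite !inE => /andP[yu exy] /andP[zu exz].
have := all_in y exy; have := all_in z exz; rewrite !inE (negPf yu) (negPf zu) /=.
(* The path cut at [y] closes to a cycle through [x]; [z] comes later on the path and so lies off
   this cycle. *)
move=> zp yp; case/splitPr: yp zp lt_yz xp xpU {all_in} => p1 p2 zp.
have [v [s rcons_p1]] : exists v s, rcons p1 y = v :: s.
  by case: (p1) => [|v s]; [exists y, [::] | exists v, (rcons s y)].
have last_s : last v s = y by rewrite -[y](last_rcons u p1) rcons_p1.
move=> lt_yz xp xpU; have zN : z \notin rcons p1 y.
  rewrite mem_rcons inE negb_or eq_sym neq /=; apply: contraL lt_yz => zp1.
  rewrite -leqNgt !index_cat zp1; apply: leq_trans (index_size _ _) _.
  case: ifP => [yp1|_]; last exact: leq_addr.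
  by move: xpU; rewrite -cat_cons -!cat_cons cat_uniq /= !inE yp1 !orbT andbF.
move: xp xpU; rewrite -cat_rcons rcons_p1 => xp xpU.
exists u, v; split; first by case/and3P: xp.
move=> c; apply: (@chord_no_hole k c x u v s z); rewrite ?last_s ?[e y x]symE //.
- by move: xp; rewrite -cat_cons cat_path => /andP[].
- by move: xpU; rewrite -!cat_cons cat_uniq => /andP[].
- by rewrite inE negb_or zu -rcons_p1.
Qed.
End Paths.

(** * Connected 2-regular graphs as labelled cycles *)

Section Cycles.

Variables (T : finType) (e : rel T).
Hypotheses (symE : symmetric e) (irrE : irreflexive e).

Local Notation E := (edges e).

(** Indices run through all of [nat] and count modulo [n], so that successors need no wrap-around
    case. *)
Definition cyclic_labelling n (V : nat -> T) :=
  [/\ 2 < n, forall i j, (V i == V j) = (i == j %[mod n]),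
      forall a, exists2 i, i < n & a = V i
    & forall i j, e (V i) (V j) = (j == i.+1 %[mod n]) || (i == j.+1 %[mod n])].

(** Besides the second vertex, [x] has a neighbor [y] on the path. Were [y] not the last vertex,
    then [x], its predecessor and its successor would be three neighbors of [y]. *)
Lemma maximal_path_closes x p :
  (forall a, degree e a = 2) -> path e x p -> uniq (x :: p) ->
  (forall y, e x y -> y \in p) -> 1 < size p /\ e (last x p) x.
Proof.
move=> deg2 xp xpU all_in.
have /card_gt1P[y [z]] : 1 < #|[set y | e x y]| by rewrite -/(degree e x) deg2.
rewrite !inE => -[exy exz].
wlog : y z exy exz / y != head x p => [gen neq|yu _].
  have [y_eq|] := eqVneq y (head x p); last by move=> ?; apply: gen neq.
  by apply: (gen z y); rewrite // eq_sym // -y_eq.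
have := all_in y exy; case: p xp xpU yu {all_in} => // u p xp xpU /= yu.
rewrite inE (negPf yu) /= => yp; case/splitPr: yp xp xpU => p1 p2 xp xpU.
split; first by rewrite size_cat addnS.
case: p2 xp xpU => [|t p2] xp xpU; first by rewrite last_cat symE.
set q := last u p1; have qp : q \in u :: p1 by apply: mem_last.
have distinct : uniq [:: x; q; t].
  move: xpU; rewrite -cat_cons cons_uniq cat_uniq => /andP[xN /and3P[_ /hasPn disj _]].
  move: xN; rewrite mem_cat !inE !negb_or => /and4P[/andP[xu xp1] _ xt _].
  rewrite /= !inE negb_or xt !andbT; apply/andP; split.
    by apply: contraTneq qp => <-; rewrite inE negb_or xu.
  by apply: contraTneq qp => ->; apply: disj; rewrite !inE eqxx orbT.
have : #|[:: x; q; t]| <= degree e y.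
  apply/subset_leq_card/subsetP => a; rewrite !inE => /or3P[] /eqP->.
  - by rewrite symE.
  - by move: xp; rewrite symE /= cat_path => /and4P[].
  - by move: xp; rewrite /= cat_path => /and3P[_ _ /and3P[]].
by rewrite (card_uniqP distinct) deg2.
Qed.

(** The closed path contains both neighbors of each of its vertices, so by connectedness it covers
    the graph. *)
Lemma cyclic_labelling_ex : connected e -> (forall a, degree e a = 2) -> T ->
  exists n V, cyclic_labelling n V.
Proof.
move=> conn deg2 x0; have [x [p [xp xpU all_in]]] := maximal_path symE irrE x0.
have [p_gt1 lastx] := maximal_path_closes deg2 xp xpU all_in.
pose n := (size p).+1; pose V i := nth x (x :: p) (i %% n).
have lt_mod i : i %% n < n by rewrite ltn_mod.
have eqV i j : (V i == V j) = (i == j %[mod n]) by rewrite /V nth_uniq.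
have nextV i : e (V i) (V i.+1).
  rewrite /V -[i.+1]addn1 -modnDml addn1.
  case: (ltngtP (i %% n).+1 n) (lt_mod i) => // [lt _|eq_n _].
    by rewrite (modn_small lt); apply: (pathP x xp).
  have -> : i %% n = size p by apply/eq_add_S/eq_n.
  by rewrite modnn (nth_last x (x :: p)).
(* Modulo [n], [i + n.-1] is the predecessor of [i]; it differs from the successor because
   [2 < n]. *)
have nbrsV i : [set b | e (V i) b] = [set V i.+1; V (i + n.-1)].
  apply/esym/eqP; rewrite eqEcard -/(degree e _) deg2; apply/andP; split.
    apply/subsetP=> a; rewrite !inE => /orP[]/eqP-> //; rewrite symE.
    have -> : V i = V (i + n.-1).+1 by apply/eqP; rewrite eqV -addnS modnDr.
    exact: nextV.
  by rewrite cards2 eqV -[i.+1]addn1 eqn_modDl !modn_small //= /n;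
    case: (size p) p_gt1 => [|[]].
exists n, V; split=> // [a|i j].
  have closed b c : e b c -> b \in x :: p -> c \in x :: p.
    move=> ebc bp; have b_eq : b = V (index b (x :: p)).
      by rewrite /V modn_small ?nth_index // index_mem.
    have : c \in [set a' | e (V (index b (x :: p))) a'] by rewrite inE -b_eq.
    by rewrite nbrsV !inE => /orP[]/eqP->; rewrite -in_cons mem_nth.
  have ap : a \in x :: p.
    have /connectP[q xq ->] := conn x a.
    elim: q {1 3 4}x (mem_head x p) xq => //= b q IHq y yp /andP[eyb].
    by apply: IHq; apply: closed yp.
  by exists (index a (x :: p)); rewrite /V ?modn_small ?nth_index ?index_mem.
have -> : e (V i) (V j) = (V j \in [set b | e (V i) b]) by rewrite inE.
rewrite nbrsV !inE !eqV; congr (_ || _).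
by rewrite -[LHS](eqn_modDr 1) -addnA !addn1 prednK // modnDr eq_sym.
Qed.

Lemma cyclic_labelling7 V : cyclic_labelling 7 V -> isomorphic_to_C7 e.
Proof.
case=> _ eqV surj adjV; pose g (i : 'I_7) := V i.
have surj_g a : exists i, g i == a.
  by have [i lt_i ->] := surj a; exists (Ordinal lt_i); rewrite /g.
pose f a := xchoose (surj_g a).
have fK a : g (f a) = a by apply/eqP/(xchooseP (surj_g a)).
have gK i : f (g i) = i.
  have /eqP := fK (g i); rewrite /g eqV !modn_small // => /eqP.
  exact: val_inj.
exists f; split; first by exists g.
move=> a b; rewrite -{1}[a]fK -{1}[b]fK adjV /cycle7 !addn1.
by rewrite !(modn_small (ltn_ord _)).
Qed.

Section Coloring.

Variables (n : nat) (V : nat -> T).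
Hypothesis labV : cyclic_labelling n V.

Let F i := [set V i; V i.+1].

Lemma cycle_edge_meet i j : F i :&: F j != set0 ->
  [|| i == j %[mod n], i == j.+1 %[mod n] | j == i.+1 %[mod n]].
Proof.
have [_ eqV _ _] := labV.
case/set0Pn=> a; rewrite !inE => /andP[/orP[]/eqP-> /orP[]]; rewrite eqV.
- by move=> ->.
- by move=> ->; rewrite orbT.
- by rewrite eq_sym => ->; rewrite !orbT.
by rewrite -addn1 -[j.+1]addn1 eqn_modDr => ->.
Qed.

Lemma cycle_edge_eq i j : i = j %[mod n] -> F i = F j.
Proof.
have [_ eqV _ _] := labV.
move=> eq_ij; have Vij : V i = V j by apply/eqP; rewrite eqV eq_ij.
suff Vij1 : V i.+1 = V j.+1 by rewrite /F Vij Vij1.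
by apply/eqP; rewrite eqV -addn1 -[j.+1]addn1 eqn_modDr eq_ij.
Qed.

Lemma cycle_edge_inj i j : F i = F j -> i = j %[mod n].
Proof.
have [n_gt2 eqV _ _] := labV; move=> eqF; apply/eqP; rewrite -eqV.
have : V i \in F j by rewrite -eqF set21.
have : V i.+1 \in F j by rewrite -eqF set22.
rewrite !inE !eqV -[i.+1]addn1 -[j.+1]addn1 !eqn_modDr => /orP[] // eq_ij2.
case/orP=> // /eqP eq_ij.
(* Matching the endvertices in reverse order would make 2 vanish modulo [n]. *)
have : j + 2 == j + 0 %[mod n].
  by rewrite addn0 -(eqP eq_ij2) -[(i + 1) %% n]modnDml eq_ij modnDml -addnA.
by rewrite eqn_modDl mod0n modn_small.
Qed.

Lemma cycle_edgeP f : reflect (exists2 i, i < n & f = F i) (f \in E).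
Proof.
have [n_gt2 eqV surj adjV] := labV.
have n_gt0 : 0 < n by rewrite ltnW // ltnW.
apply: (iffP (edgesP _ _)) => [[x [y [exy ->]]]|[i _ ->]]; last first.
  by exists (V i), (V i.+1); rewrite adjV eqxx.
have [i lt_i x_eq] := surj x; have [j lt_j y_eq] := surj y.
move: exy; rewrite x_eq y_eq adjV -!eqV => /orP[]/eqP eqV1; [exists i | exists j] => //.
  by rewrite eqV1.
by rewrite eqV1 setUC.
Qed.

Lemma cycle_edist1 i j : edist1 (F i) (F j) ->
  (i == j.+1 %[mod n]) || (j == i.+1 %[mod n]).
Proof.
case/andP=> neq /cycle_edge_meet /or3P[/eqP/cycle_edge_eq eqF|->|->]; rewrite ?orbT //.
by rewrite eqF eqxx in neq.
Qed.

(** A connecting edge [F l] has [l] within 1 of both [i] and [j] modulo [n]; disjointness leaves two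
    of the nine combinations. *)
Lemma cycle_edist2 i j : edist2 e (F i) (F j) ->
  (i == j.+2 %[mod n]) || (j == i.+2 %[mod n]).
Proof.
have [_ eqV _ _] := labV.
have succ a b : a == b %[mod n] -> a.+1 == b.+1 %[mod n].
  by rewrite -addn1 -[b.+1]addn1 eqn_modDr.
have succI a b : a.+1 == b.+1 %[mod n] -> a == b %[mod n].
  by rewrite -addn1 -[b.+1]addn1 eqn_modDr.
case/andP=> /eqP disj /existsP[h /and3P[hE]]; have [l _ ->] := cycle_edgeP _ hE.
have no a b : a \in [:: i; i.+1] -> b \in [:: j; j.+1] -> a != b %[mod n].
  move=> ai bj; rewrite -eqV; apply/negP=> /eqP eq_ab.
  suff : V a \in F i :&: F j by rewrite disj inE.
  rewrite inE {2}eq_ab.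
  by move: ai bj; rewrite !inE => /orP[]/eqP-> /orP[]/eqP->; rewrite !eqxx ?orbT.
have neq0 : i != j %[mod n] by apply: no; rewrite !inE eqxx.
have neq1 : i != j.+1 %[mod n] by apply: no; rewrite !inE eqxx ?orbT.
have neq2 : i.+1 != j %[mod n] by apply: no; rewrite !inE eqxx ?orbT.
move=> /cycle_edge_meet/or3P li /cycle_edge_meet/or3P lj.
case: li => [/eqP li|/eqP li|li]; case: lj => [/eqP lj|/eqP lj|lj].
- by rewrite -li lj eqxx in neq0.
- by rewrite -li lj eqxx in neq1.
- by rewrite (eqP lj) succ // li in neq2.
- by rewrite -li lj eqxx in neq2.
- by rewrite (succI i j) // -li lj in neq0.
- by apply/orP; right; rewrite (eqP lj); apply: succ; rewrite li.
- by rewrite (eqP li) succ // lj in neq1.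
- by apply/orP; left; rewrite (eqP li); apply: succ; rewrite lj.
by rewrite (eqP li) (eqP lj) eqxx in neq0.
Qed.


End Coloring.


End Cycles.

(** * Explicit colorings of cycles with three colors *)

(* Cyclic words over the blocks 012 and 01201: two blocks 01201 when
   [n = 3 q + 1], which needs [10 <= n], one when [n = 3 q + 2]. *)
Definition cycle_color n i :=
  if n == 4 then i %% 2
  else if (n %% 3 == 1) && (4 < i) then (i - 5) %% 3 else i %% 3.

Lemma modn_step n i m : i < n -> m < n ->
  (i + m) %% n = if i + m < n then i + m else i + m - n.
Proof.
move=> lt_in lt_mn; case: ltnP => [/modn_small //|le_n].
by rewrite -{1}(subnK le_n) modnDr modn_small // ltn_subLR //; lia.
Qed.

Lemma cycle_color_next n i j : 2 < n -> i < n -> j < n -> j = i.+1 %[mod n] ->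
  cycle_color n i != cycle_color n j.
Proof.
move=> n_gt2 lt_in lt_jn; rewrite (modn_small lt_jn) -addn1 modn_step; [|lia..].
rewrite /cycle_color; case: (n =P 4) => n4; case: ltnP => h ->;
  do ?[case: ifP]; lia.
Qed.

(** The three colors agree only for [n = 4], where [i] and [l] coincide. For [n = 7] the word
    0120101 fails: it has 1 at positions 4, 6 and 1. *)
Lemma cycle_color_next2 n i j l : 2 < n -> n != 7 -> i < n -> j < n -> l < n ->
  j = i.+2 %[mod n] -> l = j.+2 %[mod n] ->
  cycle_color n i = cycle_color n j -> cycle_color n l = cycle_color n j -> i = l.
Proof.
move=> n_gt2 n7 lt_in lt_jn lt_ln; rewrite (modn_small lt_jn) (modn_small lt_ln).
rewrite -addn2 -[j.+2]addn2 !modn_step; [|lia..].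
rewrite /cycle_color.
case: (n =P 4) => n4; (case: ltnP => h ->); (case: ltnP => h2 ->); do ?[case: ifP]; lia.
Qed.

Lemma cycle_color_lt3 n i : cycle_color n i < 3.
Proof. by rewrite /cycle_color; do ?case: ifP => _; lia. Qed.

Lemma cycle_coloring (T : finType) (e : rel T) n V :
  cyclic_labelling e n V -> n != 7 ->
  exists c : {set T} -> 'I_3, relaxed_strong_coloring e 0 1 c.
Proof.
move=> labV n7; have [n_gt2 _ _ _] := labV.
pose F i := [set V i; V i.+1].
(* The value [ord0] is a dummy for sets that are not edges. *)
pose c f : 'I_3 :=
  if [pick i : 'I_n | f == F i] is Some i then inord (cycle_color n i) else ord0.
have eqc i j : i < n -> j < n -> c (F i) == c (F j) ->
    cycle_color n i = cycle_color n j.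
  have cF l : l < n -> c (F l) = cycle_color n l :> nat.
    move=> lt_l; rewrite /c; case: pickP => [m /eqP eqF|/(_ (Ordinal lt_l))].
      rewrite inordK ?cycle_color_lt3 //.
      by have := cycle_edge_inj labV eqF; rewrite !modn_small // => ->.
    by rewrite eqxx.
  by move=> lt_i lt_j /eqP/(congr1 val) /=; rewrite !cF.
exists c => f /(cycle_edgeP labV)[i lt_i ->]; split.
  rewrite leqn0 cards_eq0; apply/eqP/setP => g; rewrite !inE.
  apply/negP=> /and3P[/(cycle_edgeP labV)[j lt_j ->]].
  move=> /(cycle_edist1 labV)/orP[]/eqP eq_ij /eqc eq_col.
    by have := cycle_color_next n_gt2 lt_j lt_i eq_ij; rewrite eq_col // eqxx.
  by have := cycle_color_next n_gt2 lt_i lt_j eq_ij; rewrite eq_col // eqxx.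
have succ2I a b : a.+2 = b.+2 %[mod n] -> a = b %[mod n].
  by move/eqP; rewrite -addn2 -[b.+2]addn2 eqn_modDr => /eqP.
apply/card_le1_eqP => g h; rewrite !inE.
case/and3P=> /(cycle_edgeP labV)[j lt_j ->] dj /eqc-/(_ lt_j lt_i) cj.
case/and3P=> /(cycle_edgeP labV)[l lt_l ->] dl /eqc-/(_ lt_l lt_i) cl.
have color2 := cycle_color_next2 n_gt2 n7.
(* Both edges lie two steps away from [F i]: on the same side they coincide, on opposite sides
   [color2] identifies them. *)
case/orP: (cycle_edist2 labV dj) => /eqP ej;
  case/orP: (cycle_edist2 labV dl) => /eqP el.
- by apply: (cycle_edge_eq labV); apply: succ2I; rewrite -ej.
- by rewrite (color2 j i l).
- by rewrite (color2 l i j).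
by apply: (cycle_edge_eq labV); rewrite ej.
Qed.

(** * Spreading the hole over the graph, and the conclusion *)

(** The hole travels along a path from an end of [f], turning at each vertex to any edge there. A
    neighbor of [x] is provided so that some edge at [x] is a hole. *)
Lemma hole_everywhere (T : finType) (e : rel T) k (c : {ffun {set T} -> 'I_k}) f :
  symmetric e -> connected e ->
  (forall f, f \in edges e -> \sum_(g in edges e) weight e f g <= k * 2) ->
  hole e c f -> forall x, (exists y, e x y) /\
    forall y, e x y -> exists c' : {ffun {set T} -> 'I_k}, hole e c' [set x; y].
Proof.
move=> symE conn row_sum hf.
have move_hole x y z (c0 : {ffun {set T} -> 'I_k}) : e x y -> e x z ->
    hole e c0 [set x; y] -> exists c' : {ffun {set T} -> 'I_k}, hole e c' [set x; z].
  move=> exy exz h0; have [<-|yz] := eqVneq y z; first by exists c0.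
  exists (recolor c0 [set x; y] (c0 [set x; z])).
  apply: (hole_move row_sum h0); first exact: mem_edges.
  apply: (@edist1_common _ x); rewrite ?set21 //.
  by apply: contraNneq yz => /set2_inj->.
have [fE _ _] := hf; case/edgesP: fE => u [v [euv f_eq]]; rewrite f_eq in hf.
have base : (exists y, e u y) /\
    forall y, e u y -> exists c' : {ffun {set T} -> 'I_k}, hole e c' [set u; y].
  by split=> [|y euy]; [exists v | apply: move_hole hf].
move=> x; have /connectP[p up ->] := conn u x.
elim: p u up base {euv f_eq hf} => //= y p IHp u /andP[euy yp] [_ holes].
apply: IHp yp _; have eyu : e y u by rewrite symE.
split=> [|z eyz]; first by exists u.
have [c' hc'] := holes y euy; apply: (move_hole y u z c') => //.
by rewrite setUC.
Qed.

(** In this form, weight below 2 in the color of [f] is exactly the (0,1)-relaxed condition at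
    [f]. *)
Lemma color_weight_card (T : finType) (e : rel T) k (c : {ffun {set T} -> 'I_k}) f b :
  color_weight e c f b =
    #|[set g in edges e | edist1 f g & c g == b]|.*2
      + #|[set g in edges e | edist2 e f g & c g == b]|.
Proof.
have count (P : pred {set T}) :
    \sum_(g in edges e | c g == b) P g = #|[set g in edges e | P g & c g == b]|.
  rewrite -sum1_card; under [RHS]eq_bigl => g do rewrite inE.
  rewrite [LHS]big_mkcondr [RHS]big_mkcondr; apply: eq_bigr => g _.
  by case: (P g); case: (_ == _).
rewrite /color_weight /weight big_split /= count; congr (_ + _).
by under eq_bigr => g _ do rewrite -mul2n; rewrite -big_distrr /= count mul2n.
Qed.

(* chi'_{(0,1)}(G) <= Delta^2 - 1, i.e. there is a (0,1)-relaxed strong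
   edge-coloring using at most Delta^2 - 1 colors. *)
Theorem theorem3 (T : finType) (e : rel T) :
  symmetric e -> irreflexive e -> connected e ->
  2 <= max_degree e -> ~ isomorphic_to_C7 e ->
  exists c : {set T} -> 'I_((max_degree e) ^ 2 - 1),
    relaxed_strong_coloring e 0 1 c.
Proof.
move=> symE irrE conn D_gt1 notC7; set k := max_degree e ^ 2 - 1.
have row_sum f : f \in edges e -> \sum_(g in edges e) weight e f g <= k * 2.
  by move=> fE; apply: sum_weight_max => //; apply: ltnW.
have k_gt0 : 0 < k by rewrite subn_gt0 -(exp1n 2) ltn_exp2r.
pose c0 : {ffun {set T} -> 'I_k} := [ffun=> Ordinal k_gt0].
case: (@arg_minnP _ c0 predT (@energy _ e k) isT) => c _ min.
have [/forallP good|] :=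
  boolP [forall f, (f \in edges e) ==> (color_weight e c f (c f) < 2)].
  exists c => f /(implyP (good f)); rewrite color_weight_card.
  move: #|_| #|_| => a b; lia.
case/forallPn=> f; rewrite negb_imply -leqNgt => /andP[fE bad].
have holes := hole_everywhere symE conn row_sum
  (hole_bad row_sum fE (fun c' => min c' isT) bad).
(* A hole at [x] sees the full weight [k * 2], which forces maximum degree there. *)
have regular x : degree e x = max_degree e.
  have [[y exy] /(_ y exy)[c' hc']] := holes x.
  by apply: (full_degree symE exy D_gt1); apply: hole_full hc'.
have [x0 _] : exists x : T, x \in T.
  by case/edgesP: fE => x _; exists x.
have [x [p [xp xpU all_in]]] := maximal_path symE irrE x0.
have [D_gt2|] := ltnP 2 (max_degree e).
  have deg : 2 < degree e x by rewrite regular.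
  have [u [v [euv no_hole]]] :=
    three_neighbors_no_hole symE irrE row_sum xp xpU all_in deg.
  by have [_ /(_ v euv)[c' /no_hole]] := holes u.
move=> D_le2; have D2 : max_degree e = 2 by apply/eqP; rewrite eqn_leq D_le2.
rewrite /k D2; have deg2 a : degree e a = 2 by rewrite regular.
have [n [V labV]] := cyclic_labelling_ex symE irrE conn deg2 x0.
apply: (cycle_coloring labV); apply/eqP => n7; apply: notC7.
by rewrite n7 in labV; apply: cyclic_labelling7 labV.
Qed.
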